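(* For $k=1,2$ let $t_k\in\mathbb{C}$ be a $4$th root of unity and let $a_k,c_k,d_k\in\mathbb{C}$ satisfy $c_k=a_k^2-a_kd_k+d_k^2$, $c_k\neq 0$ and $a_k\neq d_k$. Let $\rho_k=\rho(-1,t_k,a_k,c_k,d_k)$ be the corresponding $2$-dimensional representation of the necklace braid group $\mathcal{NB}_2$, and let $\rho=\rho_1\otimes\rho_2:\mathcal{NB}_2\to GL(4,\mathbb{C})$. Then $\rho$ is irreducible if and only if $a_1a_2\neq d_1d_2$ and $a_1d_2\neq a_2d_1$.
   Context: The necklace braid group $\mathcal{NB}_n$ is the group with generators $\sigma_1,\dots,\sigma_n,\tau$ and relations (indices taken modulo $n$, so $\sigma_{n+1}=\sigma_1$): $\sigma_i\sigma_{i+1}\sigma_i=\sigma_{i+1}\sigma_i\sigma_{i+1}$; $\sigma_i\sigma_j=\sigma_j\sigma_i$ whenever $i-j\not\equiv\pm1 \pmod n$; $\tau\sigma_i\tau^{-1}=\sigma_{i+1}$; $\tau^{2n}=1$. For the parameters considered, $\rho(T,t,a,c,d)$ denotes the representation of $\mathcal{NB}_n$ on $\mathbb{C}^2$ with $\tau\mapsto\begin{pmatrix}Tt&0\\0&t\end{pmatrix}$ and $\sigma_i\mapsto\begin{pmatrix}a&T^{i-1}\\ cT^{1-i}&d\end{pmatrix}$ for $1\le i\le n$ (here $n=2$). The tensor product is $(\rho_1\otimes\rho_2)(g)=\rho_1(g)\otimes\rho_2(g)$ (Kronecker product of matrices). *)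

(* Defs.v *)
From HB Require Import structures.
From mathcomp Require Import all_boot all_order all_algebra.
From mathcomp Require Import generic_quotient.
From mathcomp Require Import boolp reals.
From mathcomp.real_closed Require Import complex mxtens.
From mathcomp Require Import ring.

Set Implicit Arguments.
Unset Strict Implicit.
Unset Printing Implicit Defensive.

Import GRing.Theory.
Local Open Scope ring_scope.
Local Open Scope quotient_scope.

(* The letter (false, x) stands for x and (true, x) for x^-1; a presentation
   is given by a relation [rel], where [rel u v] means that u = v is imposed. *)
Notation word X := (seq (bool * X)).

Definition inv_letter (X : Type) (l : bool * X) : bool * X := (~~ l.1, l.2).
Definition inv_word (X : Type) (w : word X) : word X :=
  rev (map (@inv_letter X) w).

Inductive pres_eq (X : Type) (rel : word X -> word X -> Prop) :
  word X -> word X -> Prop :=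
| pres_eq_refl u : pres_eq rel u u
| pres_eq_sym u v : pres_eq rel u v -> pres_eq rel v u
| pres_eq_trans v u w : pres_eq rel u v -> pres_eq rel v w -> pres_eq rel u w
| pres_eq_cat u u' v v' :
    pres_eq rel u u' -> pres_eq rel v v' -> pres_eq rel (u ++ v) (u' ++ v')
| pres_eq_cancel l : pres_eq rel [:: l; inv_letter l] [::]
| pres_eq_rel u v : rel u v -> pres_eq rel u v.

Section Presented.
Variables (X : choiceType) (rel : word X -> word X -> Prop).

Definition pres_eqb (u v : word X) : bool := `[< pres_eq rel u v >].

Fact pres_eqb_refl : reflexive pres_eqb.
Proof. by move=> u; apply/asboolP; exact: pres_eq_refl. Qed.

Fact pres_eqb_sym : symmetric pres_eqb.
Proof. by move=> u v; apply/asboolP/asboolP; exact: pres_eq_sym. Qed.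

Fact pres_eqb_trans : transitive pres_eqb.
Proof.
by move=> v u w /asboolP uv /asboolP vw; apply/asboolP; apply: pres_eq_trans vw.
Qed.

Canonical pres_equiv :=
  EquivRel pres_eqb pres_eqb_refl pres_eqb_sym pres_eqb_trans.

Definition presented := {eq_quot pres_equiv}.
HB.instance Definition _ := EqQuotient.on presented.
HB.instance Definition _ := Choice.on presented.

Definition pres_class (w : word X) : presented := \pi_presented w.
Definition pres_gen (x : X) : presented := pres_class [:: (false, x)].

Lemma pres_classP u v : pres_class u = pres_class v <-> pres_eq rel u v.
Proof.
by split=> [/eqP|uv]; [rewrite eqmodE => /asboolP | apply/eqP; rewrite eqmodE;
  apply/asboolP].
Qed.

Lemma pres_repr_eq w : pres_eq rel (repr (pres_class w)) w.
Proof. by apply/pres_classP; rewrite /pres_class reprK. Qed.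

Lemma pres_ind (P : presented -> Prop) :
  (forall w, P (pres_class w)) -> forall x, P x.
Proof. by move=> Pw x; rewrite -[x]reprK; exact: Pw. Qed.

Definition pres_one : presented := pres_class [::].
Definition pres_mul (x y : presented) : presented :=
  pres_class (repr x ++ repr y).
Definition pres_inv (x : presented) : presented := pres_class (inv_word (repr x)).

Lemma pres_mulE u v :
  pres_mul (pres_class u) (pres_class v) = pres_class (u ++ v).
Proof. by apply/pres_classP; apply: pres_eq_cat; exact: pres_repr_eq. Qed.

Lemma inv_letterK : involutive (@inv_letter X).
Proof. by case=> b x; rewrite /inv_letter /= negbK. Qed.

Lemma inv_wordK : involutive (@inv_word X).
Proof. by move=> w; rewrite /inv_word map_rev revK mapK //; exact: inv_letterK. Qed.

Lemma pres_eq_mulV w : pres_eq rel (w ++ inv_word w) [::].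
Proof.
elim: w => [|l w IH]; first exact: pres_eq_refl.
have -> : (l :: w) ++ inv_word (l :: w) =
    ([:: l] ++ (w ++ inv_word w)) ++ [:: inv_letter l].
  by rewrite /inv_word /= rev_cons -cats1 catA.
apply: pres_eq_trans (pres_eq_cancel rel l).
apply: (pres_eq_cat (u' := [:: l]) (v' := [:: inv_letter l])).
  by apply: (pres_eq_cat (u' := [:: l]) (v' := [::])) => //; exact: pres_eq_refl.
exact: pres_eq_refl.
Qed.

Lemma pres_eq_mulVw w : pres_eq rel (inv_word w ++ w) [::].
Proof. by rewrite -{2}[w]inv_wordK; exact: pres_eq_mulV. Qed.

Fact pres_mulA : associative pres_mul.
Proof.
elim/pres_ind=> u; elim/pres_ind=> v; elim/pres_ind=> w.
by rewrite !pres_mulE catA.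
Qed.

Fact pres_mul1 : left_id pres_one pres_mul.
Proof. by elim/pres_ind=> u; rewrite pres_mulE. Qed.

Fact pres_mulr1 : right_id pres_one pres_mul.
Proof. by elim/pres_ind=> u; rewrite pres_mulE cats0. Qed.

Fact pres_mulV : left_inverse pres_one pres_inv pres_mul.
Proof.
move=> x; rewrite -[x in pres_mul _ x]reprK pres_mulE.
by apply/pres_classP; exact: pres_eq_mulVw.
Qed.

Fact pres_mulrV : right_inverse pres_one pres_inv pres_mul.
Proof.
move=> x; rewrite -[x in pres_mul x _]reprK pres_mulE.
by apply/pres_classP; exact: pres_eq_mulV.
Qed.

HB.instance Definition _ := isGroup.Build presented
  pres_mulA pres_mul1 pres_mulr1 pres_mulV pres_mulrV.

End Presented.

(* As G is a group, the values of such a map are automatically invertible: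
   this is a homomorphism G -> GL(m, F), acting on column vectors. *)
Record group_repr (F : fieldType) (G : groupType) (m : nat) := GroupRepr {
  repr_fun :> G -> 'M[F]_m;
  repr_fun1 : repr_fun 1%g = 1%:M;
  repr_funM : forall g h : G, repr_fun (g * h)%g = repr_fun g *m repr_fun h
}.

Definition irreducible (F : fieldType) (G : groupType) (m : nat)
    (rho : group_repr F G m) : Prop :=
  (0 < m)%N /\
  forall W : {vspace 'cV[F]_m},
    (forall (g : G) (w : 'cV[F]_m), w \in W -> rho g *m w \in W) ->
    W = 0%VS \/ W = fullv.

Section Tensor.
Variables (F : fieldType) (G : groupType) (m p : nat).
Variables (rho1 : group_repr F G m) (rho2 : group_repr F G p).

Let tensor_fun (g : G) : 'M[F]_(m * p) := rho1 g *t rho2 g.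

Fact tensor_fun1 : tensor_fun 1%g = 1%:M.
Proof.
rewrite /tensor_fun !repr_fun1; apply/matrixP=> i j.
case: (mxtens_indexP i) => i1 i2; case: (mxtens_indexP j) => j1 j2.
rewrite tensmxE !mxE -natrM mulnb.
by rewrite (can_eq (@mxtens_indexK m p)).
Qed.

Fact tensor_funM (g h : G) :
  tensor_fun (g * h)%g = tensor_fun g *m tensor_fun h.
Proof. by rewrite /tensor_fun !repr_funM tensmx_mul. Qed.

Definition tensor_repr : group_repr F G (m * p) :=
  GroupRepr tensor_fun1 tensor_funM.
End Tensor.

Section PresentedRepr.
Variables (F : fieldType) (X : choiceType) (rel : word X -> word X -> Prop).
Variables (m : nat) (f : X -> 'M[F]_m).

Definition letter_mx (l : bool * X) : 'M[F]_m :=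
  if l.1 then invmx (f l.2) else f l.2.

Definition word_mx (w : word X) : 'M[F]_m :=
  foldr (fun l A => letter_mx l *m A) 1%:M w.

Definition respects : Prop :=
  (forall x, f x \in unitmx) /\
  (forall u v, rel u v -> word_mx u = word_mx v).

Lemma word_mx_cat u v : word_mx (u ++ v) = word_mx u *m word_mx v.
Proof. by elim: u => [|l u IH] /=; rewrite ?mul1mx // IH mulmxA. Qed.

Hypothesis fP : respects.

Lemma word_mx_eq u v : pres_eq rel u v -> word_mx u = word_mx v.
Proof.
case: fP => fU frel; elim=> {u v} //.
- by move=> v u w _ -> _ ->.
- by move=> u u' v v' _ Hu _ Hv; rewrite !word_mx_cat Hu Hv.
- by case=> [[] x] /=; rewrite /letter_mx /= mulmx1 ?mulVmx ?mulmxV.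
Qed.

Let pres_repr_fun (g : presented rel) : 'M[F]_m := word_mx (repr g).

Let pres_repr_class w : pres_repr_fun (pres_class rel w) = word_mx w.
Proof. by apply: word_mx_eq; exact: pres_repr_eq. Qed.

Fact pres_repr_fun1 : pres_repr_fun 1%g = 1%:M.
Proof. by rewrite pres_repr_class. Qed.

Fact pres_repr_funM (g h : presented rel) :
  pres_repr_fun (g * h)%g = pres_repr_fun g *m pres_repr_fun h.
Proof. by rewrite pres_repr_class word_mx_cat. Qed.

Definition pres_repr : group_repr F (presented rel) m :=
  GroupRepr pres_repr_fun1 pres_repr_funM.

Lemma pres_repr_gen x : pres_repr (pres_gen rel x) = f x.
Proof. by rewrite /= pres_repr_class /= mulmx1. Qed.
End PresentedRepr.

(* Generators: [Some i] is sigma_{i+1}, for i = 0, ..., n-1, and [None] is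
   tau. The cyclic successor on indices is [ordS]. *)
Notation necklace_gen n := (option 'I_n).

Section NecklaceRel.
Variable n : nat.
Let sigma (i : 'I_n) : bool * necklace_gen n := (false, Some i).
Let tau : bool * necklace_gen n := (false, None).

Inductive necklace_rel :
  word (necklace_gen n) -> word (necklace_gen n) -> Prop :=
| necklace_braid i :
    necklace_rel [:: sigma i; sigma (ordS i); sigma i]
                 [:: sigma (ordS i); sigma i; sigma (ordS i)]
| necklace_comm i j : i != ordS j -> j != ordS i ->
    necklace_rel [:: sigma i; sigma j] [:: sigma j; sigma i]
| necklace_conj i :
    necklace_rel [:: tau; sigma i; inv_letter tau] [:: sigma (ordS i)]
| necklace_tau : necklace_rel (nseq (2 * n) tau) [::].
End NecklaceRel.

Definition necklace_group (n : nat) : groupType :=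
  presented (@necklace_rel n).

Definition necklace_sigma n (i : 'I_n) : necklace_group n :=
  pres_gen (@necklace_rel n) (Some i).
Definition necklace_tau_gen n : necklace_group n :=
  pres_gen (@necklace_rel n) None.

Definition mx2 (F : fieldType) (a b c d : F) : 'M[F]_2 :=
  \matrix_(i, j) if i == 0 then (if j == 0 then a else b)
                 else (if j == 0 then c else d).

(* Since [Some i] is sigma_{i+1}, the exponents i - 1 and 1 - i of the
   one-based formula become i and - i. *)
Definition necklace_mx (F : fieldType) (n : nat) (T t a c d : F)
    (x : necklace_gen n) : 'M[F]_2 :=
  if x is Some i then mx2 a (T ^+ i) (c * T ^- i) d
  else mx2 (T * t) 0 0 t.

Definition necklace_rho (F : fieldType) (n : nat) (T t a c d : F)
    (H : respects (@necklace_rel n) (necklace_mx T t a c d)) :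
    group_repr F (necklace_group n) 2 :=
  pres_repr H.
Arguments necklace_rho {F n} T t a c d H.

Lemma necklace_rho_sigma (F : fieldType) n (T t a c d : F)
    (H : respects (@necklace_rel n) (necklace_mx T t a c d)) (i : 'I_n) :
  necklace_rho T t a c d H (necklace_sigma i) =
  mx2 a (T ^+ i) (c * T ^- i) d.
Proof. exact: pres_repr_gen. Qed.

Lemma necklace_rho_tau (F : fieldType) n (T t a c d : F)
    (H : respects (@necklace_rel n) (necklace_mx T t a c d)) :
  necklace_rho T t a c d H (necklace_tau_gen n) = mx2 (T * t) 0 0 t.
Proof. exact: pres_repr_gen. Qed.

Lemma mx2_mul (F : fieldType) (a b c d a' b' c' d' : F) :
  mx2 a b c d *m mx2 a' b' c' d' =
  mx2 (a * a' + b * c') (a * b' + b * d') (c * a' + d * c') (c * b' + d * d').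
Proof.
apply/matrixP=> i j; rewrite !mxE !big_ord_recl big_ord0 !mxE /= addr0.
by case: i => [[|[|[]]]] //= ?; case: j => [[|[|[]]]].
Qed.

Lemma mx2_unit (F : fieldType) (a b c d : F) :
  (mx2 a b c d \in unitmx) = (a * d - b * c != 0).
Proof.
rewrite unitmxE unitfE (expand_det_row _ ord0) !big_ord_recl big_ord0 /cofactor.
by rewrite !det_mx11 !mxE /= !expr0 !mul1r expr1 mulN1r mulrN addr0.
Qed.

Lemma necklace2_respects (F : fieldType) (t a c d : F) :
  4.-unity_root t -> c = a ^+ 2 - a * d + d ^+ 2 -> a != d ->
  respects (@necklace_rel 2) (necklace_mx (-1) t a c d).
Proof.
move=> /unity_rootP t4 -> ad.
have t0 : t != 0.
  by apply/eqP=> t0; move/eqP: t4; rewrite t0 expr0n /= eq_sym oner_eq0.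
have tauU : mx2 (-1 * t) 0 0 t \in unitmx.
  by rewrite mx2_unit mul0r subr0 mulN1r mulNr oppr_eq0 mulf_neq0.
split=> [[i|//]|u v].
  rewrite mx2_unit mulrCA divff ?signr_eq0 // mulr1.
  rewrite (_ : _ - _ = - (a - d) ^+ 2); last by ring.
  by rewrite oppr_eq0 sqrf_eq0 subr_eq0.
have ord2 (i : 'I_2) : i = ord0 \/ i = ord_max.
  by case: i => [[|[|//]] Hi]; [left|right]; apply: val_inj.
have S0 : ordS (ord0 : 'I_2) = ord_max by apply: val_inj.
have S1 : ordS (ord_max : 'I_2) = ord0 by apply: val_inj.
case=> {u v} [i|i j|i|].
- by case: (ord2 i) => ->; rewrite ?S0 ?S1 /word_mx /= /letter_mx /= !mulmx1
    ?expr0 ?expr1 ?invr1 ?invrN1 !mx2_mul; congr mx2; ring.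
- by case: (ord2 i) => ->; case: (ord2 j) => ->; rewrite ?S0 ?S1.
- apply: (can_inj (mulmxK tauU)).
  rewrite /word_mx /= /letter_mx /= !mulmx1 mulmxA mulmxKV //.
  by case: (ord2 i) => ->; rewrite ?S0 ?S1 /= ?expr0 ?expr1 ?invr1 ?invrN1
    !mx2_mul; congr mx2; ring.
- rewrite /word_mx /= /letter_mx /= !mulmx1 !mx2_mul.
  transitivity (mx2 (t ^+ 4) 0 0 (t ^+ 4)); first by congr mx2; ring.
  rewrite t4; apply/matrixP=> i j; rewrite !mxE.
  by case: (ord2 i) => ->; case: (ord2 j) => ->.
Qed.

(* Main.v *)
(* The image of tau is a multiple of diag(1,-1,-1,1), so an invariant subspace
   splits along the planes V+ = <e1 e1, e2 e2> and V- = <e1 e2, e2 e1>, and it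
   is stable under the even part P and the odd part Q of sigma_1, with
   sigma_i = P + (-1)^(i-1) Q. The determinant of Q : V+ -> V- is, up to sign,
   (a1 a2 - d1 d2) (a1 d2 - a2 d1), and Q^2 - (a1 d2 + a2 d1) P is diagonal on
   V+ with entries differing by 2 (a1 a2 - d1 d2) (a1 - d1) (a2 - d2). If both
   conditions hold, then a nonzero invariant subspace meets V+, hence contains
   e1 e1 or e2 e2, hence V+ (by applying P), hence V- (by applying Q). *)
Require Import Defs.
From mathcomp Require Import all_boot all_order all_algebra.
From mathcomp Require Import reals.
From mathcomp.real_closed Require Import complex mxtens.
From mathcomp Require Import ring.
Import GRing.Theory Num.Theory.
Local Open Scope ring_scope.

(** * Coordinates on the tensor product *)

(** Coordinates in the Kronecker order e1 e1, e1 e2, e2 e1, e2 e2, so that [x], [u] are those on V+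
    and [y], [z] those on V-. *)
Definition col4 {F : fieldType} (x y z u : F) : 'cV[F]_(2 * 2) :=
  \col_i [:: x; y; z; u]`_i.

Lemma col4_surj (F : fieldType) (v : 'cV[F]_(2 * 2)) :
  exists x y z u, v = col4 x y z u.
Proof.
pose k i lt_i4 := v (@Ordinal 4 i lt_i4) 0.
exists (k 0 isT), (k 1 isT), (k 2 isT), (k 3 isT).
apply/matrixP=> i j; rewrite !mxE ord1 /k.
by case: i => [[|[|[|[|//]]]] Hi] /=; congr (v _ _); apply: val_inj.
Qed.

Lemma col4D (F : fieldType) (x y z u x' y' z' u' : F) :
  col4 x y z u + col4 x' y' z' u' = col4 (x + x') (y + y') (z + z') (u + u').
Proof.
by apply/matrixP=> i j; rewrite !mxE; case: i => [[|[|[|[|//]]]] Hi].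
Qed.

Lemma col4Z (F : fieldType) (k x y z u : F) :
  k *: col4 x y z u = col4 (k * x) (k * y) (k * z) (k * u).
Proof.
by apply/matrixP=> i j; rewrite !mxE; case: i => [[|[|[|[|//]]]] Hi].
Qed.

Lemma col4_eq0 (F : fieldType) (x y z u : F) :
  (col4 x y z u == 0) = [&& x == 0, y == 0, z == 0 & u == 0].
Proof.
apply/eqP/and4P => [/matrixP v0|[/eqP-> /eqP-> /eqP-> /eqP->]].
  pose k i lt_i4 := v0 (@Ordinal 4 i lt_i4) 0.
  move: (k 0 isT) (k 1 isT) (k 2 isT) (k 3 isT).
  by rewrite !mxE /= => -> -> -> ->.
by apply/matrixP=> i j; rewrite !mxE; case: i => [[|[|[|[|//]]]] Hi].
Qed.

Lemma tens_mx2_col4 (F : fieldType) (a b c d a' b' c' d' x y z u : F) :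
  (mx2 a b c d *t mx2 a' b' c' d') *m col4 x y z u =
  col4 (a * (a' * x + b' * y) + b * (a' * z + b' * u))
       (a * (c' * x + d' * y) + b * (c' * z + d' * u))
       (c * (a' * x + b' * y) + d * (a' * z + b' * u))
       (c * (c' * x + d' * y) + d * (c' * z + d' * u)).
Proof.
apply/matrixP=> i j; rewrite !mxE !big_ord_recl big_ord0 !mxE /= addr0.
by case: i => [[|[|[|[|//]]]] Hi] /=; ring.
Qed.

(** * Common eigenvectors and reducibility *)

(** Induction on words. An inverse letter acts on [v] by the inverse eigenvalue, which exists
    because an invertible matrix cannot kill [v]. *)
Lemma pres_repr_eigenvector (F : fieldType) (X : choiceType)
    (rel : word X -> word X -> Prop) (m : nat)
    (rho : group_repr F (presented rel) m) (v : 'cV[F]_m) :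
  v != 0 ->
  (forall x, exists k, rho (pres_gen rel x) *m v = k *: v) ->
  forall g, exists k, rho g *m v = k *: v.
Proof.
move=> v0 genP; elim/pres_ind; elim=> [|l w [k IH]].
  exists 1; rewrite -[pres_class _ _]/(1%g : presented rel).
  by rewrite repr_fun1 mul1mx scale1r.
have letterP : exists k, rho (pres_class rel [:: l]) *m v = k *: v.
  case: l => [[] x]; last exact: genP.
  have [e He] := genP x.
  have VE : (pres_class rel [:: (true, x)] * pres_gen rel x)%g = 1%g.
    rewrite -[LHS]/(pres_mul _ _) pres_mulE; apply/pres_classP.
    exact: (@pres_eq_cancel _ _ (true, x)).
  have vE : e *: (rho (pres_class rel [:: (true, x)]) *m v) = v.
    by rewrite scalemxAr -He mulmxA -repr_funM VE repr_fun1 mul1mx.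
  have e0 : e != 0 by apply: contraNneq v0 => e0; rewrite -vE e0 scale0r.
  by exists e^-1; rewrite -{2}vE scalerA mulVf // scale1r.
case: letterP => e He; exists (k * e).
have -> : pres_class rel (l :: w) =
    (pres_class rel [:: l] * pres_class rel w)%g.
  by rewrite -[RHS]/(pres_mul _ _) pres_mulE.
by rewrite repr_funM -mulmxA IH -scalemxAr He scalerA.
Qed.

(** The line spanned by [v] is invariant, and it is neither 0 nor the whole space since its
    dimension is 1 < [m]. *)
Lemma irreducible_no_eigenvector {F : fieldType} {G : groupType} {m : nat}
    {rho : group_repr F G m} {v : 'cV[F]_m} :
  (1 < m)%N -> v != 0 -> (forall g, exists k, rho g *m v = k *: v) ->
  ~ irreducible rho.
Proof.
move=> m1 v0 vP [_ /(_ <[v]>%VS)] [|W0|Wf].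
- move=> g _ /vlineP[k ->]; have [e He] := vP g.
  by rewrite -scalemxAr He !memvZ ?memv_line.
- by have := memv_line v; rewrite W0 memv0 (negPf v0).
- have := dim_vline v; rewrite Wf dimvf /dim /= muln1 v0 => m1E.
  by rewrite m1E in m1.
Qed.

(** * Action of the generators on the tensor product *)

Section NecklaceTensor.
Variables (F : fieldType) (t1 a1 c1 d1 t2 a2 c2 d2 : F).
Hypothesis two_neq0 : 2 != 0 :> F.
Hypotheses (t1_neq0 : t1 != 0) (t2_neq0 : t2 != 0).
Hypotheses (hc1 : c1 = a1 ^+ 2 - a1 * d1 + d1 ^+ 2)
  (hc2 : c2 = a2 ^+ 2 - a2 * d2 + d2 ^+ 2).
Hypotheses (c1_neq0 : c1 != 0) (c2_neq0 : c2 != 0).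
Hypotheses (had1 : a1 != d1) (had2 : a2 != d2).

Definition necklace_tens (x : necklace_gen 2) : 'M[F]_(2 * 2) :=
  necklace_mx (-1) t1 a1 c1 d1 x *t necklace_mx (-1) t2 a2 c2 d2 x.

Lemma necklace_tens_tau x y z u :
  necklace_tens None *m col4 x y z u =
  (t1 * t2) *: col4 x (- y) (- z) u.
Proof. by rewrite tens_mx2_col4 col4Z; congr col4; ring. Qed.

(** This is the splitting P + (-1)^i Q: a product of two off-diagonal entries loses its sign, a
    product with exactly one keeps it. P preserves V+ and V-, and Q exchanges them. *)
Lemma necklace_tens_sigma (i : 'I_2) x y z u :
  necklace_tens (Some i) *m col4 x y z u =
  col4 (a1 * a2 * x + u) (a1 * d2 * y + c2 * z)
       (c1 * y + d1 * a2 * z) (c1 * c2 * x + d1 * d2 * u) +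
  (-1) ^+ i *: col4 (a1 * y + a2 * z) (a1 * c2 * x + d2 * u)
       (c1 * a2 * x + d1 * u) (c1 * d2 * y + d1 * c2 * z).
Proof.
rewrite /necklace_tens /necklace_mx tens_mx2_col4 col4Z col4D.
by case: i => [[|[|//]] _] /=; rewrite ?expr0 ?expr1 ?invr1 ?invrN1;
  congr col4; ring.
Qed.

Lemma necklace_tens_stable (W : {vspace 'cV[F]_(2 * 2)}) :
  a1 * a2 != d1 * d2 -> a1 * d2 != a2 * d1 ->
  (forall x w, w \in W -> necklace_tens x *m w \in W) ->
  W = 0%VS \/ W = fullv.
Proof.
move=> h1 h2 stW.
have evenP x y z u : col4 x y z u \in W -> col4 x 0 0 u \in W.
  move=> wW; have := stW None _ wW; rewrite necklace_tens_tau.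
  rewrite rpredZeq !mulf_eq0 (negPf t1_neq0) (negPf t2_neq0) /= => /(rpredD wW).
  move/(rpredZ 2^-1); rewrite col4D col4Z.
  by congr (col4 _ _ _ _ \in W); field.
have sumP x y z u : col4 x y z u \in W ->
    col4 (a1 * a2 * x + u) (a1 * d2 * y + c2 * z)
         (c1 * y + d1 * a2 * z) (c1 * c2 * x + d1 * d2 * u) \in W.
  move=> wW; have := rpredD (stW (Some ord0) _ wW) (stW (Some ord_max) _ wW).
  rewrite !necklace_tens_sigma expr0 expr1 scale1r scaleN1r addrACA subrr addr0.
  by rewrite -mulr2n -scaler_nat rpredZeq (negPf two_neq0).
have diffP x y z u : col4 x y z u \in W ->
    col4 (a1 * y + a2 * z) (a1 * c2 * x + d2 * u)
         (c1 * a2 * x + d1 * u) (c1 * d2 * y + d1 * c2 * z) \in W.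
  move=> wW; have := rpredB (stW (Some ord0) _ wW) (stW (Some ord_max) _ wW).
  rewrite !necklace_tens_sigma expr0 expr1 scale1r scaleN1r opprD opprK.
  rewrite addrACA subrr add0r.
  by rewrite -mulr2n -scaler_nat rpredZeq (negPf two_neq0).
(* The same expression is the determinant of Q from V+ to V- and from V- to V+. *)
have det_neq0 : a1 * c2 * d1 - d2 * (c1 * a2) != 0.
  rewrite (_ : _ - _ = (a1 * a2 - d1 * d2) * (d1 * a2 - a1 * d2)).
    by rewrite mulf_neq0 // subr_eq0 // eq_sym [d1 * _]mulrC.
  by rewrite hc1 hc2; ring.
(* The diagonal entries on V+ of Q^2 - (a1 d2 + a2 d1) P; the coefficient is the common ratio of the
   off-diagonal entries of Q^2 to those of P. *)
pose f := a1 ^+ 2 * c2 + a2 ^+ 2 * c1 - (a1 * d2 + a2 * d1) * (a1 * a2).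
pose g := c1 * d2 ^+ 2 + d1 ^+ 2 * c2 - (a1 * d2 + a2 * d1) * (d1 * d2).
have fg_neq0 : f - g != 0.
  rewrite (_ : _ - _ = 2 * (a1 * a2 - d1 * d2) * (a1 - d1) * (a2 - d2)).
    by rewrite !mulf_neq0 ?subr_eq0.
  by rewrite /f /g hc1 hc2; ring.
have diagP x y z u : col4 x y z u \in W -> col4 (f * x) 0 0 (g * u) \in W.
  move=> /evenP wW; have := rpredB (diffP _ _ _ _ (diffP _ _ _ _ wW))
    (rpredZ (a1 * d2 + a2 * d1) (sumP _ _ _ _ wW)).
  rewrite -scaleN1r !col4Z col4D => /evenP; congr (col4 _ _ _ _ \in W);
  by rewrite /f /g; ring.
have e1P x y z u : col4 x y z u \in W -> col4 x 0 0 0 \in W.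
  move=> wW; have := rpredB (diagP _ _ _ _ wW) (rpredZ g (evenP _ _ _ _ wW)).
  rewrite -scaleN1r !col4Z col4D => /(rpredZ (f - g)^-1); rewrite col4Z.
  by congr (col4 _ _ _ _ \in W); field.
have e4P x y z u : col4 x y z u \in W -> col4 0 0 0 u \in W.
  move=> wW; have := rpredB (evenP _ _ _ _ wW) (e1P _ _ _ _ wW).
  by rewrite -scaleN1r !col4Z col4D; congr (col4 _ _ _ _ \in W); ring.
have planeP (x u : F) : (x != 0) || (u != 0) -> col4 x 0 0 u \in W ->
    forall x' u', col4 x' 0 0 u' \in W.
  move=> nz wW.
  have [X [XW X0]] : exists X, col4 X 0 0 0 \in W /\ X != 0.
    (* If [x] is 0, then P sends u e2 e2 to a vector whose e1 e1 coordinate is [u]. *)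
    have [x0|x0] := eqVneq x 0; last by exists x; split=> //; apply: e1P wW.
    exists u; split; last by rewrite x0 eqxx in nz.
    by have /sumP/e1P := e4P _ _ _ _ wW; congr (col4 _ _ _ _ \in W); ring.
  move=> x' u'; have /(rpredZ (x' / X)) := XW.
  (* P sends X e1 e1 to a vector with e2 e2 coordinate c1 c2 X, hence the divisor. *)
  have /e4P/(rpredZ (u' / (c1 * c2 * X))) := sumP _ _ _ _ XW.
  rewrite !col4Z => UW XW'; have := rpredD XW' UW; rewrite col4D.
  by congr (col4 _ _ _ _ \in W); field; rewrite ?X0 ?c1_neq0 ?c2_neq0.
have fullP (x u : F) : (x != 0) || (u != 0) -> col4 x 0 0 u \in W -> W = fullv.
  move=> nz wW; apply/eqP; rewrite eqEsubv subvf /=; apply/subvP=> v _.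
  have [X [Y [Z [U ->]]]] := col4_surj _ v.
  have WX := planeP _ _ nz wW.
  (* Cramer's rule gives the vector of V+ that Q maps to the V- part of [v]. *)
  pose D := a1 * c2 * d1 - d2 * (c1 * a2).
  have := rpredD (WX X U) (diffP _ _ _ _
    (WX ((d1 * Y - d2 * Z) / D) ((a1 * c2 * Z - c1 * a2 * Y) / D))).
  by rewrite col4D; congr (col4 _ _ _ _ \in W); rewrite /D; field.
have [->|Wn0] := eqVneq W 0%VS; [by left | right].
have: vpick W != 0 by rewrite vpick0.
have: vpick W \in W by exact: memv_pick.
have [x [y [z [u ->]]]] := col4_surj _ (vpick W) => wW; rewrite col4_eq0.
have [nz _|] := boolP ((x != 0) || (u != 0)).
  exact: fullP nz (evenP _ _ _ _ wW).
rewrite negb_or !negbK => /andP[/eqP x0 /eqP u0].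
rewrite x0 u0 !eqxx andbT => yz_neq0.
(* The picked vector lies in V-; its image under Q lies in V+ and is nonzero because Q is injective
   on V-. *)
apply: fullP (evenP _ _ _ _ (diffP _ _ _ _ wW)).
apply: contraNT yz_neq0; rewrite negb_or !negbK => /andP[/eqP q1 /eqP q2].
have Dy : (a1 * c2 * d1 - d2 * (c1 * a2)) * y = 0.
  transitivity (d1 * c2 * (a1 * y + a2 * z) - a2 * (c1 * d2 * y + d1 * c2 * z)).
    by ring.
  by rewrite q1 q2 !mulr0 subrr.
have Dz : (a1 * c2 * d1 - d2 * (c1 * a2)) * z = 0.
  transitivity (a1 * (c1 * d2 * y + d1 * c2 * z) - c1 * d2 * (a1 * y + a2 * z)).
    by ring.
  by rewrite q1 q2 !mulr0 subrr.
move/eqP: Dy; move/eqP: Dz.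
by rewrite !mulf_eq0 (negPf det_neq0) /= => -> ->.
Qed.

(* Under either equation the odd part of sigma_i is singular on one of the two
   eigenplanes of tau, and its kernel there is an eigenline of the even part. *)
Lemma necklace_tens_eigenvector :
  a1 * a2 = d1 * d2 \/ a1 * d2 = a2 * d1 ->
  exists2 v : 'cV[F]_(2 * 2), v != 0 &
    forall x, exists k, necklace_tens x *m v = k *: v.
Proof.
(* The four equations say that a vector of V+ satisfies Q v = 0 and P v = k v; [inner] is the
   analogue on V-. *)
have outer (k x u : F) : (x != 0) || (u != 0) ->
    a1 * c2 * x + d2 * u = 0 -> c1 * a2 * x + d1 * u = 0 ->
    a1 * a2 * x + u = k * x -> c1 * c2 * x + d1 * d2 * u = k * u ->
    exists2 v : 'cV[F]_(2 * 2), v != 0 &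
    forall x, exists k, necklace_tens x *m v = k *: v.
  move=> nz e1 e2 e3 e4; exists (col4 x 0 0 u).
    by rewrite col4_eq0 !eqxx /= negb_and.
  case=> [i|]; last by exists (t1 * t2); rewrite necklace_tens_tau oppr0.
  exists k; rewrite necklace_tens_sigma !col4Z col4D e1 e2 e3 e4.
  by congr col4; ring.
have inner (k y z : F) : (y != 0) || (z != 0) ->
    a1 * y + a2 * z = 0 -> c1 * d2 * y + d1 * c2 * z = 0 ->
    a1 * d2 * y + c2 * z = k * y -> c1 * y + d1 * a2 * z = k * z ->
    exists2 v : 'cV[F]_(2 * 2), v != 0 &
    forall x, exists k, necklace_tens x *m v = k *: v.
  move=> nz e1 e2 e3 e4; exists (col4 0 y z 0).
    by rewrite col4_eq0 !eqxx /= andbT negb_and.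
  case=> [i|].
    exists k; rewrite necklace_tens_sigma !col4Z col4D e1 e2 e3 e4.
    by congr col4; ring.
  exists (- (t1 * t2)); rewrite necklace_tens_tau !col4Z.
  by congr col4; ring.
case=> h.
(* The kernel vector (d1, -c1 a2) comes from the second row of Q : V+ -> V-. If d1 = 0 that row
   vanishes, and the first row gives (d2, -a1 c2). In both cases [k] is read off the first
   coordinate. *)
- have [d10|d10] := eqVneq d1 0.
    have a20 : a2 = 0.
      by move/eqP: h; rewrite d10 mul0r mulf_eq0 -d10 (negPf had1) => /eqP.
    have d2_neq0 : d2 != 0 by rewrite -a20 eq_sym.
    apply: (outer (- (a1 * d2)) d2 (- (a1 * c2))); first (by rewrite d2_neq0);
      by rewrite ?hc1 ?hc2 ?a20 ?d10; ring.
  have d2E : d2 = a1 * a2 / d1 by rewrite h; field.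
  apply: (outer (a1 * a2 - c1 * a2 / d1) d1 (- (c1 * a2)));
    first (by rewrite d10);
    by rewrite ?hc1 ?hc2 ?d2E; field.
(* The first row of Q : V- -> V+ gives (a2, -a1). If a2 = 0 that row vanishes, and since then c_k =
   d_k^2 the second row is d1 d2 (d1, d2), which kills (d2, -d1). *)
- have [a20|a20] := eqVneq a2 0.
    have a10 : a1 = 0.
      move/eqP: h; rewrite a20 mul0r mulf_eq0 => /orP[/eqP//|/eqP d20].
      by move: had2; rewrite a20 d20 eqxx.
    have d2_neq0 : d2 != 0 by rewrite -a20 eq_sym.
    apply: (inner (- (d1 * d2)) d2 (- d1)); first (by rewrite d2_neq0);
      by rewrite ?hc1 ?hc2 ?a20 ?a10; ring.
  have d1E : d1 = a1 * d2 / a2 by rewrite h; field.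
  apply: (inner (a1 * d2 - c2 * a1 / a2) a2 (- a1)); first (by rewrite a20);
    by rewrite ?hc1 ?hc2 ?d1E; field.
Qed.

End NecklaceTensor.

(** * From the generators to the necklace braid group *)

Theorem theorem3p17 (R : realType)
    (t1 a1 c1 d1 t2 a2 c2 d2 : R[i])
    (ht1 : 4.-unity_root t1) (ht2 : 4.-unity_root t2)
    (hc1 : c1 = a1 ^+ 2 - a1 * d1 + d1 ^+ 2)
    (hc2 : c2 = a2 ^+ 2 - a2 * d2 + d2 ^+ 2)
    (hc1_neq0 : c1 != 0) (hc2_neq0 : c2 != 0)
    (had1 : a1 != d1) (had2 : a2 != d2) :
  irreducible
    (tensor_repr
      (@necklace_rho _ 2 (-1) t1 a1 c1 d1 (necklace2_respects ht1 hc1 had1))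
      (@necklace_rho _ 2 (-1) t2 a2 c2 d2 (necklace2_respects ht2 hc2 had2)))
  <-> a1 * a2 != d1 * d2 /\ a1 * d2 != a2 * d1.
Proof.
set rho := tensor_repr _ _.
have rho_gen x : rho (pres_gen _ x) = necklace_tens _ t1 a1 c1 d1 t2 a2 c2 d2 x.
  by congr (_ *t _); exact: pres_repr_gen.
have unity_neq0 (t : R[i]) : 4.-unity_root t -> t != 0.
  move=> /unity_rootP; apply: contra_eq_neq => ->.
  by rewrite expr0n eq_sym oner_eq0.
split=> [irr|[h1 h2]].
  apply/andP; rewrite -negb_or; apply/orP=> h.
  have [|v v0 genP] :=
      @necklace_tens_eigenvector _ t1 a1 c1 d1 t2 a2 c2 d2 hc1 hc2 had1 had2.
    by case: h => /eqP; [left|right].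
  case: (irreducible_no_eigenvector _ v0 _ irr) => //.
  by apply: pres_repr_eigenvector => // x; rewrite rho_gen.
split=> // W stW.
apply: (@necklace_tens_stable _ t1 a1 c1 d1 t2 a2 c2 d2) => //.
- by rewrite pnatr_eq0.
- exact: unity_neq0.
- exact: unity_neq0.
- by move=> x w wW; rewrite -rho_gen; apply: stW.
Qed.
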